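(* There exists a function $c:\mathbb{N}^3\to\mathbb{N}$ with the following property. Let $q$ be a prime power, let $M$ be a $\mathrm{GF}(q)$-representable matroid, let $N$ be a minor of $M$, let $S,T\subseteq E(M)$ be disjoint, and let $k:=\kappa_M(S,T)$. If $|E(M)-(S\cup T\cup E(N))|>c(q,|E(N)|,k)$, then there exists an element $e\in E(M)-(S\cup T\cup E(N))$ such that at least one of the following holds: (1) $\kappa_{M\setminus e}(S,T)=k$ and $N$ is a minor of $M\setminus e$; (2) $\kappa_{M/e}(S,T)=k$ and $N$ is a minor of $M/e$.
   Context: For a matroid $M$ with ground set $E$ and rank function $r_M$, the connectivity function is $\lambda_M(X):=r_M(X)+r_M(E-X)-r(M)$ for $X\subseteq E$. For disjoint $S,T\subseteq E$, the connectivity between $S$ and $T$ is $\kappa_M(S,T):=\min\{\lambda_M(X): S\subseteq X\subseteq E-T\}$. Here $M\setminus e$ and $M/e$ denote deletion and contraction of $e$. *)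

(* Defs.v *)
From HB Require Import structures.
From mathcomp Require Import all_boot all_order all_algebra all_field.
Set Implicit Arguments. Unset Strict Implicit. Unset Printing Implicit Defensive.

(* A matroid on a subset of the elements of a finite universe type [U]:
   a ground set together with a rank function (only its values on subsets
   of the ground set matter). *)
Record matroid (U : finType) := Matroid {
  ground : {set U};
  rank : {set U} -> nat
}.

Section Matroids.
Variable U : finType.
Implicit Types (M N : matroid U) (X Y S T : {set U}) (e : U).

Definition is_matroid M : Prop :=
  [/\ forall X, X \subset ground M -> rank M X <= #|X|,
      forall X Y, X \subset Y -> Y \subset ground M -> rank M X <= rank M Y
    & forall X Y, X \subset ground M -> Y \subset ground M ->
        rank M (X :|: Y) + rank M (X :&: Y) <= rank M X + rank M Y].

Definition rk M : nat := rank M (ground M).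

Definition mdelete M e : matroid U :=
  Matroid (ground M :\ e) (rank M).
Definition mcontract M e : matroid U :=
  Matroid (ground M :\ e) (fun X => rank M (e |: X) - rank M [set e]).

Definition is_minor N M : Prop :=
  exists C D : {set U},
    [/\ C \subset ground M, D \subset ground M, [disjoint C & D],
        ground N = ground M :\: (C :|: D)
      & forall X, X \subset ground N ->
          rank N X = rank M (X :|: C) - rank M C].

Definition lambda M X : nat :=
  rank M X + rank M (ground M :\: X) - rk M.

Definition kappa M S T : nat :=
  \big[minn/#|ground M|]_(X : {set U} | (S \subset X) && (X \subset ground M :\: T))
     lambda M X.

Definition representable_over (F : fieldType) M : Prop :=
  exists (n : nat) (v : U -> 'rV[F]_n),
    forall X, X \subset ground M ->
      rank M X = \rank (\sum_(x in X) <<v x>>)%MS.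

Definition prime_power (q : nat) : Prop :=
  exists p k, [/\ prime p, 0 < k & q = p ^ k].

Definition GF_representable (q : nat) M : Prop :=
  exists F : finFieldType, #|F| = q /\ representable_over F M.

End Matroids.

(* Main.v *)
Require Import Defs.
From mathcomp Require Import all_boot all_order all_algebra all_field.
From mathcomp Require Import zify.
Set Implicit Arguments. Unset Strict Implicit. Unset Printing Implicit Defensive.

(* Write N = M / C \ D, let k = kappa(S, T) and suppose that no element of
   F = E - (S + T + E(N)) can be removed.  Then contracting e in C (deleting e in D),
   for e in F, lowers kappa, so e lies in the guts (coguts) of separations of order k.
   The sets X between S and E - T with lambda(X) = k form a lattice, and a maximal
   chain in it adds the elements of F one at a time; if F is large, some
   X_0, X_1, ..., X_L adds single elements of F only.  In a representation the
   k-dimensional intersections of span(X_i) and span(E - X_i) are identified along the chain,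
   and the effect of the contractions and deletions in X_i - X_0 is recorded by
   a linear relation on GF(q)^k.  If the relations at i < j agree, N is also
   obtained by exchanging contraction and deletion on all of X_j - X_i.  By
   Tutte's linking argument, the element added at i can be removed in
   the exchanged way without lowering kappa. *)

(* [lia] also processes boolean hypotheses and compares atoms up to conversion,
   which is prohibitively slow here; hence the clearing and generalizing. *)
Ltac matroid_lia :=
  repeat match goal with
  | |- context [kappa ?m ?s ?t] =>
      let z := fresh "z" in set (z := kappa m s t) in *; clearbody z
  | _ : context [kappa ?m ?s ?t] |- _ =>
      let z := fresh "z" in set (z := kappa m s t) in *; clearbody z
  | |- context [lambda ?m ?x] =>
      let z := fresh "z" in set (z := lambda m x) in *; clearbody z
  | _ : context [lambda ?m ?x] |- _ =>
      let z := fresh "z" in set (z := lambda m x) in *; clearbody z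
  | |- context [rank ?m ?x] =>
      let z := fresh "z" in set (z := rank m x) in *; clearbody z
  | _ : context [rank ?m ?x] |- _ =>
      let z := fresh "z" in set (z := rank m x) in *; clearbody z
  end;
  repeat match goal with
  | H : is_true (_ \subset _) |- _ => clear H
  | H : is_true (_ \in _) |- _ => clear H
  | H : is_true (_ \notin _) |- _ => clear H
  | H : is_true [disjoint _ & _] |- _ => clear H
  end; lia.

(** * Set identities and attained minima *)

Lemma setUDK (U : finType) (A B : {set U}) :
  A \subset B -> A :|: (B :\: A) = B.
Proof.
by move=> AB; rewrite setUC setDE setUIl [~: A :|: A]setUC setUCr setIT; apply/setUidPl.
Qed.

Lemma setIDK (U : finType) (A B : {set U}) : A :&: (B :\: A) = set0.
Proof. by rewrite setIDA setIC -setIDA setDv setI0. Qed.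

Section BigMin.
Variables (I : eqType) (x : nat) (F : I -> nat) (P : pred I).

Lemma bigminn_le (r : seq I) i :
  i \in r -> P i -> \big[minn/x]_(j <- r | P j) F j <= F i.
Proof.
elim: r => [//|j r IHr]; rewrite inE big_cons => /orP[/eqP <-|ir] Pi.
  by rewrite Pi geq_minl.
case: ifP => _; last exact: IHr.
by rewrite geq_min IHr ?orbT.
Qed.

(** The minimum also ranges over the default [x]; an index with value at most [x] ensures that the
    result is a genuine value of [F]. *)
Lemma bigminn_attained (r : seq I) i :
  i \in r -> P i -> F i <= x ->
  exists2 j, P j & \big[minn/x]_(j <- r | P j) F j = F j.
Proof.
move=> ir Pi Fx.
have [E|//] : \big[minn/x]_(j <- r | P j) F j = x \/
    exists2 j, P j & \big[minn/x]_(j <- r | P j) F j = F j.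
  elim/big_ind: _ => [|a b Ha Hb|j Pj]; first by left.
    by rewrite /minn; case: ltnP.
  by right; exists j.
exists i => //; apply/eqP; rewrite eqn_leq bigminn_le //= E //.
Qed.
End BigMin.

(** * Tight sets, guts and coguts *)

Section Connectivity.
Variables (U : finType) (M : matroid U).
Hypothesis mM : is_matroid M.
Local Notation E := (ground M).
Local Notation r := (rank M).
Implicit Types (X Y S T : {set U}) (e : U).

Lemma rank_card X : X \subset E -> r X <= #|X|.
Proof. by case: mM => H _ _; apply: H. Qed.

Lemma rank_mono X Y : X \subset Y -> Y \subset E -> r X <= r Y.
Proof. by case: mM => _ H _; apply: H. Qed.

Lemma rank_submod X Y A B : X \subset E -> Y \subset E ->
  A = X :|: Y -> B = X :&: Y -> r A + r B <= r X + r Y.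
Proof. by case: mM => _ _ H XE YE -> ->; apply: H. Qed.

(** Submodularity for [X] and its complement shows that the truncated subtraction in [lambda] is
    exact, so that later arguments are linear arithmetic. *)
Lemma lambdaE X : X \subset E -> lambda M X + r E = r X + r (E :\: X).
Proof.
move=> XE; rewrite /lambda /rk subnK //.
have := @rank_submod X (E :\: X) E set0 XE (subsetDl _ _).
rewrite setUDK // setIDK => /(_ erefl erefl); exact: leq_trans (leq_addr _ _).
Qed.

Lemma lambda_submod X Y : X \subset E -> Y \subset E ->
  lambda M (X :&: Y) + lambda M (X :|: Y) <= lambda M X + lambda M Y.
Proof.
move=> XE YE; have := lambdaE XE; have := lambdaE YE.
have IE : X :&: Y \subset E by rewrite subIset ?XE.
have UE : X :|: Y \subset E by rewrite subUset XE.
have := lambdaE IE; have := lambdaE UE.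
have := rank_submod XE YE erefl erefl.
have := @rank_submod (E :\: X) (E :\: Y) _ _ (subsetDl _ _) (subsetDl _ _)
  (setDIr E X Y) (setDUr E X Y).
matroid_lia.
Qed.

Variables (S T : {set U}).
Hypotheses (SE : S \subset E) (dST : [disjoint S & T]).
Local Notation kap := (kappa M S T).

Lemma kappa_le (M' : matroid U) X :
  S \subset X -> X \subset ground M' :\: T -> kappa M' S T <= lambda M' X.
Proof.
move=> SX XT; apply: bigminn_le; first by rewrite mem_index_enum.
by rewrite SX XT.
Qed.

(** The set [S] is itself admissible, and the bound on [lambda M' S] keeps the default value of the
    minimum from interfering. *)
Lemma kappa_attained (M' : matroid U) :
  S \subset ground M' -> lambda M' S <= #|ground M'| ->
  exists X, [/\ S \subset X, X \subset ground M' :\: T &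
     kappa M' S T = lambda M' X].
Proof.
move=> SM lS.
have [] := @bigminn_attained _ #|ground M'| (lambda M')
  (fun X => (S \subset X) && (X \subset ground M' :\: T))
  (index_enum {set U}) S _ _ lS.
- by rewrite mem_index_enum.
- by rewrite subxx subsetD SM dST.
- by move=> X /andP[SX XT] kX; exists X.
Qed.

(** * Deletion and contraction of one element *)

Section Element.
Variable e : U.
Hypotheses (eE : e \in E) (eS : e \notin S) (eT : e \notin T).

Lemma rank_step X : X \subset E :\ e ->
  [/\ r X <= r (e |: X), r (e |: X) <= r X + r [set e] &
      r E + r X <= r (e |: X) + r (E :\ e)].
Proof.
move=> /subsetD1P[XE eX].
have eXE : e |: X \subset E by rewrite subUset sub1set eE.
split; first by apply: rank_mono; rewrite ?subsetUr.
  have := @rank_submod [set e] X (e |: X) ([set e] :&: X).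
  rewrite sub1set => /(_ eE XE erefl erefl); matroid_lia.
apply: rank_submod; rewrite ?subsetDl //.
  apply/setP => z; rewrite !inE; case: eqP => [->|_] //=.
  by case: (boolP (z \in X)) => // /(subsetP XE) ->.
apply/setP => z; rewrite !inE; case: eqP => [->|_] //=; first exact: negbTE.
by case: (boolP (z \in X)) => // /(subsetP XE) ->.
Qed.

Lemma rank1 : r [set e] <= 1.
Proof. by rewrite -(cards1 e) rank_card // sub1set. Qed.

Lemma rankE_step : r (E :\ e) <= r E /\ r E <= r (E :\ e) + r [set e].
Proof.
have [] := @rank_step (E :\ e) (subxx _).
by rewrite setD1K.
Qed.

Let co X := E :\ e :\: X.

Lemma co_sub X : co X \subset E :\ e.
Proof. exact: subsetDl. Qed.

Lemma setD_step X : X \subset E :\ e -> E :\: X = e |: co X.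
Proof.
move=> /subsetD1P[XE eX]; apply/setP => z; rewrite !inE.
by case: eqP => [->|_] /=; rewrite ?eE ?eX.
Qed.

Lemma setD1_step X : E :\: (e |: X) = co X.
Proof. by apply/setP => z; rewrite !inE negb_or; case: eqP; case: (z \in X). Qed.

(** All four connectivities are expressed without subtraction through the ranks of [X] and [co X],
    with and without [e]. *)
Lemma lambda_step X : X \subset E :\ e ->
  [/\ lambda M X + r E = r X + r (e |: co X),
      lambda M (e |: X) + r E = r (e |: X) + r (co X),
      lambda (mdelete M e) X + r (E :\ e) = r X + r (co X) &
      lambda (mcontract M e) X + r E + r [set e] =
        r (e |: X) + r (e |: co X)].
Proof.
move=> XEe; have /subsetD1P[XE eX] := XEe.
have eXE : e |: X \subset E by rewrite subUset sub1set eE.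
split.
- by rewrite lambdaE // setD_step.
- by rewrite lambdaE // setD1_step.
- rewrite /lambda /rk /= subnK //.
  have := @rank_submod X (co X) (E :\ e) set0 XE.
  rewrite (subset_trans (co_sub _)) ?subsetDl // => /(_ isT).
  rewrite setUDK // setIDK => /(_ erefl erefl).
  exact: leq_trans (leq_addr _ _).
- rewrite /lambda /rk /= -/(co X) setD1K //.
  have ecE : e |: co X \subset E.
    by rewrite subUset sub1set eE (subset_trans (co_sub _)) ?subsetDl.
  have Ue : e |: X :|: (e |: co X) = E.
    by rewrite setUACA setUid setUDK // setD1K.
  have Ie : (e |: X) :&: (e |: co X) = [set e].
    by rewrite -setUIr setIDK setU0.
  have := rank_submod eXE ecE (esym Ue) (esym Ie).
  have m1 : r [set e] <= r (e |: X) by apply: rank_mono; rewrite // subsetUl.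
  have m2 : r [set e] <= r (e |: co X) by apply: rank_mono; rewrite // subsetUl.
  have m3 : r [set e] <= r E by apply: rank_mono; rewrite ?sub1set.
  matroid_lia.
Qed.

Lemma subD_step X : (X \subset E :\ e :\: T) = (X \subset E :\: T) && (e \notin X).
Proof. by rewrite setDDl setUC -setDDl subsetD1. Qed.

Let SEe : S \subset E :\ e. Proof. by rewrite subsetD1 SE. Qed.

Lemma kappa_del_attained : exists X,
  [/\ S \subset X, X \subset E :\ e :\: T &
      kappa (mdelete M e) S T = lambda (mdelete M e) X].
Proof.
apply: (kappa_attained (M' := mdelete M e)) => //=.
have [_ _ h _] := lambda_step SEe.
have h1 := rank_card SE; have h2 := subset_leq_card SEe.
have : r (co S) <= r (E :\ e) by apply: rank_mono; rewrite ?co_sub ?subsetDl.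
by rewrite -/(mdelete M e); matroid_lia.
Qed.

Lemma kappa_con_attained : exists X,
  [/\ S \subset X, X \subset E :\ e :\: T &
      kappa (mcontract M e) S T = lambda (mcontract M e) X].
Proof.
apply: (kappa_attained (M' := mcontract M e)) => //=.
have [_ _ _ h] := lambda_step SEe.
have h1 := rank_card SE; have h2 := subset_leq_card SEe.
have [_ h3 _] := rank_step SEe.
have : r (e |: co S) <= r E.
  apply: rank_mono => //; rewrite subUset sub1set eE.
  by rewrite (subset_trans (co_sub _)) ?subsetDl.
matroid_lia.
Qed.

Lemma kappa_M_attained : exists X,
  [/\ S \subset X, X \subset E :\: T & kappa M S T = lambda M X].
Proof.
apply: kappa_attained => //.
have h := lambdaE SE; have h1 := rank_card SE; have h2 := subset_leq_card SE.
have : r (E :\: S) <= r E by apply: rank_mono; rewrite ?subsetDl.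
matroid_lia.
Qed.

(** Dropping [e] from a minimizer for [M] gives an admissible set for both minors, and neither minor
    increases its connectivity. *)
Lemma kappa_minor_le :
  kappa (mdelete M e) S T <= kap /\ kappa (mcontract M e) S T <= kap.
Proof.
have [X [SX XT ->]] := kappa_M_attained.
have [Z [SZ ZT XZ]] : exists Z : {set U},
    [/\ S \subset Z, Z \subset E :\ e :\: T & X = e |: Z \/ X = Z].
  exists (X :\ e); split.
  - by rewrite subsetD1 SX.
  - by rewrite subD_step !inE eqxx (subset_trans (subsetDl _ _)).
  - have [eX|eX] := boolP (e \in X); first by left; rewrite setD1K.
    by right; apply/esym/setDidPl; rewrite disjoint_sym disjoints1.
have ZE : Z \subset E :\ e by rewrite (subset_trans ZT) ?subsetDl.
have [l1 l2 l3 l4] := lambda_step ZE.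
have [a1 a2 a3] := rank_step ZE.
have [b1 b2 b3] := rank_step (co_sub Z).
have k1 := kappa_le (M' := mdelete M e) SZ ZT.
have k2 := kappa_le (M' := mcontract M e) SZ ZT.
by case: XZ => ->; matroid_lia.
Qed.

(** Tutte's linking argument. Uncross a minimizer [X] for deletion with a minimizer [Y] for
    contraction: [X :&: Y] and [e |: (X :|: Y)] are admissible in [M], and submodularity gives [2 *
    kap <= lambda (mdelete M e) X + lambda (mcontract M e) Y + 1]. Hence the two values cannot both
    be below [kap]. *)
Lemma kappa_del_or_con :
  kap <= kappa (mdelete M e) S T \/ kap <= kappa (mcontract M e) S T.
Proof.
have [X [SX XT ->]] := kappa_del_attained.
have [Y [SY YT ->]] := kappa_con_attained.
have XE : X \subset E :\ e by rewrite (subset_trans XT) ?subsetDl.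
have YE : Y \subset E :\ e by rewrite (subset_trans YT) ?subsetDl.
have [_ _ lX _] := lambda_step XE.
have [_ _ _ lY] := lambda_step YE.
have IE : X :&: Y \subset E :\ e by rewrite subIset ?XE.
have UE : X :|: Y \subset E :\ e by rewrite subUset XE.
have [lI _ _ _] := lambda_step IE.
have [_ lU _ _] := lambda_step UE.
move: XT YT; rewrite !subD_step => /andP[XT eX] /andP[YT eY].
have kI : kap <= lambda M (X :&: Y).
  by apply: kappa_le; rewrite ?subsetI ?SX // subIset ?XT.
have kU : kap <= lambda M (e |: (X :|: Y)).
  apply: kappa_le; last by rewrite !subUset sub1set !inE eT eE XT.
  by rewrite (subset_trans SX) // setUCA subsetUl.
have s1 : r (e |: (X :|: Y)) + r (X :&: Y) <= r (e |: Y) + r X.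
  apply: rank_submod.
  - by rewrite subUset sub1set eE (subset_trans YE) ?subsetDl.
  - by rewrite (subset_trans XE) ?subsetDl.
  - by rewrite -setUA (setUC Y).
  - apply/setP => z; rewrite !inE; case: eqP => [->|_]; last by rewrite andbC.
    by rewrite (negbTE eX).
have s2 : r (e |: co (X :&: Y)) + r (co (X :|: Y)) <= r (e |: co Y) + r (co X).
  apply: rank_submod.
  - by rewrite subUset sub1set eE (subset_trans (co_sub _)) ?subsetDl.
  - by rewrite (subset_trans (co_sub _)) ?subsetDl.
  - by rewrite /co setDIr -setUA (setUC (co Y)).
  - apply/setP => z; rewrite /co !inE; case: eqP => [->|_]; rewrite ?andbF //=.
    by rewrite negb_or; case: (z \in X); case: (z \in Y); case: (z \in E).
have := rank1; have := rankE_step; matroid_lia.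
Qed.

Definition tight X :=
  [&& S \subset X, X \subset E :\: T & lambda M X == kap].

Lemma tight_intro X : S \subset X -> X \subset E :\: T -> lambda M X <= kap ->
  tight X.
Proof. by move=> SX XT l; rewrite /tight SX XT eqn_leq l kappa_le. Qed.

(** Putting [e] back on either side of [X] raises the connectivity by at most one, from a value
    below [kap]. *)
Lemma tight_of_small X : S \subset X -> X \subset E :\ e :\: T ->
  lambda (mdelete M e) X < kap \/ lambda (mcontract M e) X < kap ->
  [/\ tight X, e \notin X & tight (e |: X)].
Proof.
rewrite subD_step => SX /andP[XT eX].
have XE : X \subset E :\ e by rewrite subsetD1 eX (subset_trans XT) ?subsetDl.
have [l1 l2 l3 l4] := lambda_step XE.
have [a1 a2 a3] := rank_step XE.
have [b1 b2 b3] := rank_step (co_sub X).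
have := rank1; have := rankE_step => c1 c2 H.
split => //; apply: tight_intro => //; first matroid_lia.
- by rewrite (subset_trans SX) ?subsetUr.
- by rewrite subUset sub1set !inE eT eE.
- matroid_lia.
Qed.

Lemma tight_exists :
  kappa (mdelete M e) S T < kap \/ kappa (mcontract M e) S T < kap ->
  exists X, [/\ tight X, e \notin X & tight (e |: X)].
Proof.
have [X [SX XT lX]] := kappa_del_attained.
have [Y [SY YT lY]] := kappa_con_attained.
rewrite lX lY; case=> h; [exists X | exists Y]; apply: tight_of_small; auto.
Qed.

Section Step.
Variable X : {set U}.
Hypotheses (tX : tight X) (eX : e \notin X) (teX : tight (e |: X)).

(** By linking, deletion keeps the connectivity at least [kap]. For a minimizer [Y] of the
    contraction, deletion thus gives a larger value than contraction, so [e] is not a coloop.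
    Comparing the deletion bound at [X] with the tightness of [X] and [e |: X] then gives both
    equalities. *)
Lemma guts_step : kappa (mcontract M e) S T < kap ->
  r (e |: X) = r X /\ r (e |: co X) = r (co X).
Proof.
move: tX teX => /and3P[SX XT /eqP l] /and3P[_ _ /eqP le] kc.
have [kd|] := kappa_del_or_con; last by matroid_lia.
have XE : X \subset E :\ e by rewrite subsetD1 eX (subset_trans XT) ?subsetDl.
have [l1 l2 l3 l4] := lambda_step XE.
have [a1 a2 a3] := rank_step XE.
have [b1 b2 b3] := rank_step (co_sub X).
have := rank1; have := rankE_step => c1 c2.
have kX : kappa (mdelete M e) S T <= lambda (mdelete M e) X.
  by apply: kappa_le => //; rewrite subD_step XT.
have [Y [SY YT lY]] := kappa_con_attained.
have kY : kappa (mdelete M e) S T <= lambda (mdelete M e) Y by apply: kappa_le.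
have YE : Y \subset E :\ e by rewrite (subset_trans YT) ?subsetDl.
have [m1 m2 m3 m4] := lambda_step YE.
have [d1 d2 d3] := rank_step YE.
have [f1 f2 f3] := rank_step (co_sub Y).
matroid_lia.
Qed.

(** Dual to the guts case: here the minimizer [Y] for deletion shows that [e] is not a loop. *)
Lemma coguts_step : kappa (mdelete M e) S T < kap ->
  r (e |: X) = (r X).+1 /\ r (e |: co X) = (r (co X)).+1.
Proof.
move: tX teX => /and3P[SX XT /eqP l] /and3P[_ _ /eqP le] kc.
have [|kd] := kappa_del_or_con; first by matroid_lia.
have XE : X \subset E :\ e by rewrite subsetD1 eX (subset_trans XT) ?subsetDl.
have [l1 l2 l3 l4] := lambda_step XE.
have [a1 a2 a3] := rank_step XE.
have [b1 b2 b3] := rank_step (co_sub X).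
have := rank1; have := rankE_step => c1 c2.
have kX : kappa (mcontract M e) S T <= lambda (mcontract M e) X.
  by apply: kappa_le => //; rewrite subD_step XT.
have [Y [SY YT lY]] := kappa_del_attained.
have kY : kappa (mcontract M e) S T <= lambda (mcontract M e) Y.
  by apply: kappa_le.
have YE : Y \subset E :\ e by rewrite (subset_trans YT) ?subsetDl.
have [m1 m2 m3 m4] := lambda_step YE.
have [d1 d2 d3] := rank_step YE.
have [f1 f2 f3] := rank_step (co_sub Y).
matroid_lia.
Qed.
End Step.
End Element.

(** Both new connectivities are at least [kap], while submodularity bounds their sum by
    [2 * kap]. *)
Lemma tightIU X Y : tight X -> tight Y -> tight (X :&: Y) /\ tight (X :|: Y).
Proof.
move=> /and3P[SX XT /eqP lX] /and3P[SY YT /eqP lY].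
have SI : S \subset X :&: Y by rewrite subsetI SX.
have IT : X :&: Y \subset E :\: T by rewrite subIset ?XT.
have SU : S \subset X :|: Y by rewrite subsetU ?SX.
have UT : X :|: Y \subset E :\: T by rewrite subUset XT.
have XE := subset_trans XT (subsetDl _ _).
have YE := subset_trans YT (subsetDl _ _).
have := lambda_submod XE YE.
have kI := kappa_le (M' := M) SI IT; have kU := kappa_le (M' := M) SU UT.
by split; apply: tight_intro => //; matroid_lia.
Qed.

End Connectivity.

(** * Chains of tight sets *)

Lemma minor_delete (U : finType) (M N : matroid U) (C D : {set U}) (e : U) :
  C \subset ground M -> D \subset ground M -> [disjoint C & D] ->
  ground N = ground M :\: (C :|: D) ->
  (forall X : {set U}, X \subset ground N ->
     rank N X = rank M (X :|: C) - rank M C) ->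
  e \in D -> is_minor N (mdelete M e).
Proof.
move=> CE DE dCD gN rN eD; have eC : e \notin C by rewrite (disjointFl dCD).
exists C, (D :\ e); split => //=; first by rewrite subsetD1 CE.
- exact: setSD.
- by rewrite disjoint_sym (disjointWl (subsetDl _ _)) // disjoint_sym.
- rewrite gN; apply/setP => z; rewrite !inE !negb_or negb_and negbK.
  by case: eqP => [->|_]; rewrite ?eD ?(negbTE eC) /= ?andbF.
Qed.

Lemma minor_contract (U : finType) (M N : matroid U) (C D : {set U}) (e : U) :
  is_matroid M ->
  C \subset ground M -> D \subset ground M -> [disjoint C & D] ->
  ground N = ground M :\: (C :|: D) ->
  (forall X : {set U}, X \subset ground N ->
     rank N X = rank M (X :|: C) - rank M C) ->
  e \in C -> is_minor N (mcontract M e).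
Proof.
move=> mM CE DE dCD gN rN eC; have eD : e \notin D by rewrite (disjointFr dCD).
exists (C :\ e), D; split => //=; first exact: setSD.
- by rewrite subsetD1 DE.
- by rewrite (disjointWl (subsetDl _ _)).
- rewrite gN; apply/setP => z; rewrite !inE !negb_or negb_and negbK.
  by case: eqP => [->|_]; rewrite ?eC ?(negbTE eD) /= ?andbF.
- move=> X XN; rewrite rN // setUCA setD1K //.
  have XE : X \subset ground M by rewrite (subset_trans XN) // gN subsetDl.
  have h1 : rank M [set e] <= rank M C by apply: (rank_mono mM); rewrite ?sub1set.
  have h2 : rank M C <= rank M (X :|: C).
    by apply: (rank_mono mM); rewrite ?subsetUr // subUset XE.
  matroid_lia.
Qed.

Section Run.
Variables (U : finType) (M : matroid U) (S T EN : {set U}).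
Hypotheses (mM : is_matroid M) (SE : S \subset ground M)
  (dST : [disjoint S & T]).
Local Notation F := (ground M :\: (S :|: T :|: EN)).
Local Notation tight := (tight M S T).
Hypothesis tF : forall e, e \in F ->
  exists X : {set U}, [/\ tight X, e \notin X & tight (e |: X)].

(** Tightness is demanded of the target only; along a path it propagates from a tight starting
    set. *)
Definition run_step : rel {set U} := fun X Y =>
  tight Y && [exists e in F, (e \notin X) && (Y == e |: X)].

Let tI X Y (tX : tight X) (tY : tight Y) := (tightIU mM tX tY).1.
Let tU X Y (tX : tight X) (tY : tight Y) := (tightIU mM tX tY).2.

(* Minimality of [Y]: each element of [F] is added alone to some tight set, and
   restricting that step to [Y] shows that it is also added alone to [X]. *)
Lemma next_tight X : tight X -> ~~ (F \subset X) ->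
  exists Y, [/\ tight Y, X \proper Y & run_step X Y \/ Y :\: X \subset EN].
Proof.
move=> tX /subsetPn[e0 /tF[X0 [tX0 _ tX0e]] e0X].
pose p Y := tight Y && (X \proper Y).
have p0 : p (X :|: (e0 |: X0)).
  rewrite /p tU // properE subsetUl; apply/subsetPn; exists e0 => //.
  by rewrite !inE eqxx orbT.
have [Y /minsetP[/andP[tY XY] minY] _] := minset_exists p0.
exists Y; split => //; have sXY := proper_sub XY.
have [/existsP[e /andP[]]|noe] := boolP [exists e in F, e \in Y :\: X].
  move=> eF /setDP[eY eX]; left.
  have [Xe [tXe eXe teXe]] := tF eF.
  pose W1 := X :|: (Y :&: (e |: Xe)); pose W2 := X :|: (Y :&: Xe).
  have tW1 : tight W1 by rewrite tU // tI.
  have tW2 : tight W2 by rewrite tU // tI.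
  have W1Y : W1 = Y.
    apply: minY; last by rewrite subUset sXY subsetIl.
    rewrite /p tW1 properE subsetUl; apply/subsetPn; exists e => //.
    by rewrite !inE eqxx eY orbT.
  have W2X : W2 = X.
    apply/eqP; rewrite eqEsubset subsetUl andbT; apply: contraT => W2X.
    have W2Y : W2 = Y.
      apply: minY; last by rewrite subUset sXY subsetIl.
      by rewrite /p tW2 properE subsetUl.
    by move: eY; rewrite -W2Y !inE (negbTE eX) (negbTE eXe) andbF.
  rewrite /run_step tY; apply/existsP; exists e; rewrite eF eX /=.
  have Ye : Y :&: [set e] = [set e] by apply/setIidPr; rewrite sub1set.
  by rewrite -{1}W1Y -W2X /W1 /W2 setIUr Ye setUCA.
(* The elements of [Y :\: X] avoid [S], which lies in [X], and avoid [T], since [Y] is tight. Those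
   outside [F] are therefore in [EN]. *)
right; apply/subsetP => z zYX; apply: contraNT noe => zN.
apply/existsP; exists z; rewrite zYX andbT.
move: zYX tX tY; rewrite inE => /andP[zX zY] /and3P[SX _ _] /and3P[_ /subsetP YT _].
move: (YT z zY); rewrite !inE (negbTE zN) => /andP[zT zE].
by rewrite zE (negbTE zT) !orbF andbT; apply: contra zX; apply/subsetP.
Qed.

Lemma path_tight_last X s : tight X -> path run_step X s -> tight (last X s).
Proof.
by elim: s X => //= Y s IHs X tX /andP[/andP[tY _]]; apply: IHs.
Qed.

(** An amortized count. A step adding one element of [F] moves one unit from [#|F :\: last X s|] to
    [size s]. Any other step absorbs an element of [EN], which frees [L] units and pays for
    restarting from the empty run. The bound [m] on the uncovered ground elements ensures
    termination. *)
Lemma extend_run L m X s :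
  #|ground M :\: last X s| <= m -> tight X -> path run_step X s -> size s <= L ->
  L * #|EN :\: last X s|.+1 <= #|F :\: last X s| + size s ->
  exists X' s', [/\ tight X', path run_step X' s' & size s' = L].
Proof.
elim: m X s => [|m IHm] X s.
  rewrite leqn0 cards_eq0 setD_eq0 => EX tX ps sL.
  have -> : F :\: last X s = set0 by apply/eqP; rewrite setD_eq0 (subset_trans (subsetDl _ _)).
  by rewrite cards0 => h; exists X, s; split => //; lia.
move=> hm tX ps; rewrite leq_eqVlt => /orP[/eqP sL _|sL h]; first by exists X, s.
set Z := last X s in hm h *.
have tZ : tight Z by apply: path_tight_last ps.
have FZ : ~~ (F \subset Z).
  by apply/negP; rewrite -setD_eq0 -cards_eq0 => /eqP FZ; move: h; rewrite FZ; lia.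
have [Y [tY ZY]] := next_tight tZ FZ.
have YE : Y \subset ground M.
  by case/and3P: tY => _ /subset_trans-> //; rewrite subsetDl.
have EYZ : #|ground M :\: Y| < #|ground M :\: Z|.
  case/properP: ZY => sZY [x xY xZ]; apply: proper_card; apply/properP.
  split; first exact: setDS.
  by exists x; rewrite !inE ?xY ?xZ // (subsetP YE).
have {EYZ}Ym : #|ground M :\: Y| <= m by rewrite -ltnS (leq_trans EYZ).
have [stepY _|nstep [//|YN]] := boolP (run_step Z Y).
  apply: (IHm X (rcons s Y)); rewrite ?last_rcons ?size_rcons //.
    by rewrite rcons_path ps.
  have : #|EN :\: Y| <= #|EN :\: Z| by rewrite subset_leq_card // setDS ?proper_sub.
  move: h; have -> : #|F :\: Z| = #|F :\: Y|.+1.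
    case/andP: stepY => _ /existsP[e /and3P[eF eZ /eqP ->]].
    have -> : F :\: (e |: Z) = (F :\: Z) :\ e by rewrite [RHS]setDDl [Z :|: _]setUC.
    by rewrite (cardsD1 e (F :\: Z)) in_setD eF eZ.
  clear -L; move: #|_| #|_| #|_| => a b c; nia.
apply: (IHm Y [::]) => //=.
have -> : #|F :\: Y| = #|F :\: Z|.
  congr #|pred_of_set _|; apply/setP => z; rewrite !inE.
  have [zY|zY] := boolP (z \in Y); last first.
    by rewrite (contra (subsetP (proper_sub ZY) z) zY).
  have [//|zZ] := boolP (z \in Z).
  by rewrite (subsetP YN) ?orbT // inE zZ.
have : #|EN :\: Y| < #|EN :\: Z|.
  case/properP: ZY => sZY [x xY xZ]; apply: proper_card; apply/properP.
  have xN : x \in EN by rewrite (subsetP YN) // inE xZ.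
  split; first exact: setDS.
  by exists x; rewrite !inE ?xY ?xZ.
move: h; clear -sL; move: #|_| #|_| #|_| => a b c; nia.
Qed.

(** A minimal tight set is disjoint from [F]: intersecting it with a tight set that misses [e] would
    otherwise shrink it. All of [F] is then still available, and the elements of [EN] interrupt the
    chain at most [#|EN|] times. *)
Lemma long_run L : L * #|EN|.+1 <= #|F| ->
  exists X s, [/\ tight X, path run_step X s & size s = L].
Proof.
move=> hL.
have [X0 [SX0 X0T kX0]] := kappa_M_attained mM SE dST.
have t0 : tight X0 by rewrite /tight SX0 X0T kX0 eqxx.
have [X /minsetP[tX minX] _] := minset_exists t0.
have FX : F :\: X = F.
  apply/setDidPl; rewrite disjoint_subset; apply/subsetP => e eF.
  rewrite inE; apply/negP => eX; have [Xe [tXe eXe _]] := tF eF.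
  have XXe := minX _ (tI tX tXe) (subsetIl _ _).
  by move: eX; rewrite -XXe inE (negbTE eXe) andbF.
apply: (@extend_run L _ X [::]) => //=; rewrite FX addn0.
apply: leq_trans hL; rewrite leq_mul2l ltnS subset_leq_card ?orbT //.
exact: subsetDl.
Qed.
End Run.

(** * Linear algebra along a chain *)

Section Span.
Import GRing.Theory.
Variables (U : finType) (K : fieldType) (n : nat) (v : U -> 'rV[K]_n).
Local Open Scope ring_scope.

(** This is the expression in [representable_over], so a representation hypothesis applies by
    conversion. *)
Definition span (X : {set U}) : 'M[K]_n := (\sum_(x in X) <<v x>>)%MS.

Lemma mem_span (X : {set U}) x : x \in X -> (v x <= span X)%MS.
Proof. by move=> xX; apply: (sumsmx_sup x); rewrite ?genmxE. Qed.

Lemma spanP m (X : {set U}) (W : 'M_(m, n)) :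
  reflect (forall x, x \in X -> (v x <= W)%MS) (span X <= W)%MS.
Proof.
apply: (iffP idP) => [XW x xX|XW]; first exact: submx_trans (mem_span xX) XW.
by apply/sumsmx_subP => x xX; rewrite genmxE XW.
Qed.

Lemma spanS (X Y : {set U}) : X \subset Y -> (span X <= span Y)%MS.
Proof. by move/subsetP=> XY; apply/spanP => x /XY; apply: mem_span. Qed.

Lemma span_setU (X Y : {set U}) : (span (X :|: Y) :=: span X + span Y)%MS.
Proof.
apply/eqmxP/andP; split; last by rewrite addsmx_sub !spanS ?subsetUl ?subsetUr.
apply/spanP => x; rewrite inE => /orP[] /mem_span h.
  exact: submx_trans h (addsmxSl _ _).
exact: submx_trans h (addsmxSr _ _).
Qed.

Lemma span_setU1 x (X : {set U}) : (span (x |: X) :=: v x + span X)%MS.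
Proof.
apply: eqmx_trans (span_setU _ _) _; apply: adds_eqmx => //.
by rewrite /span big_set1; apply: genmxE.
Qed.

Lemma sub_spanU1 x (X : {set U}) m (w : 'M_(m, n)) :
  (v x <= span X)%MS -> (w <= span (x |: X))%MS -> (w <= span X)%MS.
Proof.
by rewrite span_setU1 => vx /submx_trans; apply; rewrite addsmx_sub vx submx_refl.
Qed.

Lemma cap_row0 m (x : 'rV[K]_n) (W : 'M_(m, n)) :
  ~~ (x <= W)%MS -> (x :&: W = 0)%MS.
Proof.
move=> xW; apply/eqP; rewrite -submx0; apply/row_subP => i.
have : (row i (x :&: W)%MS <= x :&: W)%MS by apply: row_sub.
rewrite sub_capmx => /andP[/sub_rVP[a ->]].
have [->|a0] := eqVneq a 0; first by rewrite scale0r !sub0mx.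
by rewrite eqmx_scale // (negbTE xW).
Qed.

(* The intersections [span X :&: span Y] on the two sides of a coguts element
   [x] differ, but projecting along [x] identifies them. *)
Lemma guts_transport k (B : 'M[K]_(k, n)) (X Y : {set U}) (x : U) :
  (B :=: span X :&: span (x |: Y))%MS ->
  \rank (span (x |: X) :&: span Y) = k -> \rank B = k ->
  ~~ (v x <= span X)%MS -> ~~ (v x <= span Y)%MS ->
  exists B' : 'M[K]_(k, n),
    (B' :=: span (x |: X) :&: span Y)%MS /\ (B' - B <= v x)%MS.
Proof.
move=> BG rG rB xX xY.
pose V : 'M_n := <<v x>>%MS; pose B' := B *m proj_mx (span Y) V.
have dYV : (span Y :&: V = 0)%MS.
  apply/eqP; rewrite -submx0 capmxC; apply: submx_trans (_ : v x :&: span Y <= _)%MS.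
    by rewrite capmxS // genmxE.
  by rewrite cap_row0.
have BYV : (B <= span Y + V)%MS.
  rewrite BG; apply: submx_trans (capmxSr _ _) _.
  by rewrite span_setU1 addsmxC addsmxS // genmxE.
have BX : (B <= span X)%MS by rewrite BG capmxSl.
have dB : (B - B' <= v x)%MS.
  by have := proj_mx_compl_sub BYV; rewrite genmxE.
have dB' : (B' - B <= v x)%MS by rewrite -opprB eqmx_opp.
have B'G : (B' <= span (x |: X) :&: span Y)%MS.
  rewrite sub_capmx proj_mx_sub andbT -[B'](subrK B) span_setU1.
  by rewrite addmx_sub_adds.
exists B'; split => //; apply/eqmxP; rewrite B'G /=.
(* Projecting loses no rank: [v x] meets [B] trivially because [B] lies in [span X], and [v x + B]
   is contained in [v x + B']. *)
have rB' : (k <= \rank B')%N.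
  have : (v x + B <= v x + B')%MS.
    rewrite addsmx_sub addsmxSl -{1}[B](subrK B') /=; exact: addmx_sub_adds.
  move/mxrankS; have := mxrank_sum_cap (v x) B.
  have -> : (v x :&: B = 0)%MS.
    apply/eqP; rewrite -submx0; apply: submx_trans (capmxS _ BX) _ => //.
    by rewrite cap_row0.
  rewrite mxrank0 rB; have [+ _] := mxrank_adds_leqif (v x) B'; lia.
by rewrite -(geq_leqif (mxrank_leqif_sup B'G)) rG.
Qed.

(** When [W] and [W'] meet [P] in the same subspace, so do their intersections with any [Z] inside
    [P]. By the modular law, quotienting by either one then gives [Z] the same rank. *)
Lemma rank_adds_exchange m1 m2 m3 m4 (P : 'M[K]_(m1, n)) (Z : 'M_(m2, n))
    (W : 'M_(m3, n)) (W' : 'M_(m4, n)) :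
  (forall r : 'rV_n, (r <= P)%MS -> (r <= W)%MS = (r <= W')%MS) ->
  (Z <= P)%MS ->
  (\rank (Z + W)%MS + \rank W' = \rank (Z + W')%MS + \rank W)%N.
Proof.
move=> WW' ZP; have := mxrank_sum_cap Z W; have := mxrank_sum_cap Z W'.
have -> : (Z :&: W :=: Z :&: W')%MS; last by lia.
apply/eqmxP/andP; split; apply/row_subP => i; rewrite sub_capmx.
  have := row_sub i (Z :&: W)%MS; rewrite !sub_capmx => /andP[rZ rW].
  by rewrite rZ -WW' // (submx_trans rZ).
have := row_sub i (Z :&: W')%MS; rewrite !sub_capmx => /andP[rZ rW].
by rewrite rZ WW' // (submx_trans rZ).
Qed.

(** * Guts subspaces along a chain of sets *)

Section Walk.
Variables (E C : {set U}) (X : nat -> {set U}) (k L : nat).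
Local Notation Y i := (E :\: X i).
Hypothesis XE : forall i, (i <= L)%N -> X i \subset E.
Hypothesis rG : forall i, (i <= L)%N -> \rank (span (X i) :&: span (Y i)) = k.
Hypothesis stepX : forall i, (i < L)%N -> exists e,
  [/\ e \in E, e \notin X i, X i.+1 = e |: X i &
   if e \in C then (v e <= span (X i))%MS && (v e <= span (Y i.+1))%MS
   else ~~ (v e <= span (X i))%MS && ~~ (v e <= span (Y i.+1))%MS].

Lemma walk_co i e : e \in E -> e \notin X i -> X i.+1 = e |: X i ->
  Y i = e |: Y i.+1.
Proof.
move=> eE eX ->; apply/setP => z; rewrite !inE negb_or.
by case: eqP => [->|_] //=; rewrite eE eX.
Qed.

Lemma walkS i j : (i <= j)%N -> (j <= L)%N -> X i \subset X j.
Proof.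
elim: j => [|j IHj]; first by rewrite leqn0 => /eqP->.
rewrite leq_eqVlt => /orP[/eqP -> //|]; rewrite ltnS => ij jL.
have [e [_ _ -> _]] := stepX jL.
by rewrite (subset_trans (IHj ij (ltnW jL))) ?subsetUr.
Qed.

(** The bases are built one step at a time. An element of [C] is spanned by both sides and leaves
    the intersection unchanged, so the basis is kept; any other element lies in neither span, and
    [guts_transport] projects along it. Corresponding rows thus agree modulo the elements added
    outside [C]. *)
Lemma walk_bases m : (m <= L)%N -> exists B : nat -> 'M[K]_(k, n),
  (forall i, (i <= m)%N -> (B i :=: span (X i) :&: span (Y i))%MS) /\
  (forall i, (i < m)%N -> (B i.+1 - B i <= span (X i.+1 :\: X i :\: C))%MS).
Proof.
elim: m => [_|m IHm mL].
  have [B0 B0G] : exists B : 'M[K]_(k, n),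
      (B :=: span (X 0%N) :&: span (Y 0%N))%MS.
    by rewrite -(rG (leq0n L)); exists (row_base _); apply: eq_row_base.
  by exists (fun=> B0); split=> // i; rewrite leqn0 => /eqP->.
have [B [BG dB]] := IHm (ltnW mL).
have [e [eE eX XS eC]] := stepX mL.
have YS := walk_co eE eX XS.
suff [B' [B'G dB']] : exists B' : 'M[K]_(k, n),
    (B' :=: span (X m.+1) :&: span (Y m.+1))%MS /\
    (B' - B m <= span (X m.+1 :\: X m :\: C))%MS.
  exists (fun i => if i == m.+1 then B' else B i); split => i im.
    by have [->//|ne] := eqVneq i m.+1; apply: BG; rewrite -ltnS ltn_neqAle ne.
  rewrite (_ : (i == m.+1) = false); last by apply/eqP => iE; rewrite iE ltnn in im.
  have [[->]//|ne] := eqVneq i.+1 m.+1.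
  by apply: dB; rewrite -ltnS ltn_neqAle ne.
move: eC; case: ifP => [eC /andP[eX' eY']|eC /andP[eX' eY']].
  exists (B m); rewrite subrr sub0mx; split => //.
  have XmS : X m \subset X m.+1 by rewrite XS subsetUr.
  apply: eqmx_trans (BG m (leqnn m)) _.
  apply/eqmxP; rewrite XS YS -XS; apply/andP; split; rewrite sub_capmx; apply/andP; split.
  - exact: submx_trans (capmxSl _ _) (spanS XmS).
  - by apply: sub_spanU1 eY' _; apply: capmxSr.
  - by apply: sub_spanU1 eX' _; rewrite -XS; apply: capmxSl.
  - exact: submx_trans (capmxSr _ _) (spanS (subsetUr _ _)).
have := @guts_transport k (B m) (X m) (Y m.+1) e.
rewrite -YS -XS => /(_ (BG m (leqnn m)) (rG mL)).
case=> [||//|B' [B'G dB']] //.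
  by rewrite (BG m (leqnn m)) (rG (ltnW mL)).
exists B'; split => //; apply: submx_trans dB' _.
by rewrite mem_span // XS !inE eqxx eX eC.
Qed.

Variable B : nat -> 'M[K]_(k, n).
Hypothesis BG : forall i, (i <= L)%N -> (B i :=: span (X i) :&: span (Y i))%MS.
Hypothesis dB :
  forall i, (i < L)%N -> (B i.+1 - B i <= span (X i.+1 :\: X i :\: C))%MS.

Lemma walk_bases_diff i j : (i <= j)%N -> (j <= L)%N ->
  (B j - B i <= span (X j :\: X i :\: C))%MS.
Proof.
elim: j => [|j IHj]; first by rewrite leqn0 => /eqP-> _; rewrite subrr sub0mx.
rewrite leq_eqVlt => /orP[/eqP -> _|]; first by rewrite subrr sub0mx.
rewrite ltnS => ij jL; rewrite -[B j.+1](subrK (B j)) -addrA addmx_sub //.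
  apply: submx_trans (dB jL) (spanS _).
  by rewrite setSD // setDS // walkS // ltnW.
apply: submx_trans (IHj ij (ltnW jL)) (spanS _).
by rewrite setSD // setSD // walkS.
Qed.

(** Each element outside [C] that the chain adds lies outside the span of the preceding set. These
    elements are thus independent modulo [span (X i)] and add nothing to the part of [span A] inside
    it. *)
Lemma walk_indep i j (A : {set U}) (u : 'rV[K]_n) :
  (i <= j)%N -> (j <= L)%N -> A \subset X i -> (u <= span (X i))%MS ->
  (u <= span (A :|: (X j :\: X i :\: C)))%MS -> (u <= span A)%MS.
Proof.
move=> + + AX uX; elim: j => [|j IHj].
  by rewrite leqn0 => /eqP-> _; rewrite setDv set0D setU0.
rewrite leq_eqVlt => /orP[/eqP <- _|]; first by rewrite setDv set0D setU0.
rewrite ltnS => ij jL uW; apply: (IHj ij (ltnW jL)); move: uW.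
have [e [_ eX XS eC]] := stepX jL; move: eC.
have eXi : e \notin X i by apply: contra eX; apply/subsetP/walkS => //; apply: ltnW.
set W := A :|: (X j :\: X i :\: C).
have WX : (span W <= span (X j))%MS.
  rewrite spanS // subUset (subset_trans AX (walkS ij (ltnW jL))) /=.
  by rewrite setDDl subsetDl.
case: ifP => [eC _|eC /andP[eX' _]].
  suff -> : A :|: (X j.+1 :\: X i :\: C) = W by [].
  apply/setP => z; rewrite XS !inE; case: eqP => [->|_] //.
  by rewrite eC /= orbF.
have -> : A :|: (X j.+1 :\: X i :\: C) = e |: W.
  apply/setP => z; rewrite XS !inE; case: eqP => [->|_] //.
  by rewrite eC eXi orbT.
rewrite span_setU1 => /sub_addsmxP[[a w] /= uE].
have wX : (w *m span W <= span (X j))%MS by rewrite (submx_trans (submxMl _ _)).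
have uXj : (u <= span (X j))%MS.
  by rewrite (submx_trans uX) // spanS // walkS // ltnW.
(* A nonzero coefficient of [v e] would put [v e] itself into [span (X j)]. *)
have : (a *m v e <= span (X j))%MS.
  rewrite (_ : a *m v e = u - w *m span W); last by rewrite uE addrK.
  by rewrite addmx_sub // eqmx_opp.
have : (a *m v e <= v e)%MS by apply: submxMl.
case/sub_rVP => c cE; rewrite cE in uE *; rewrite uE.
have [->|c0] := eqVneq c 0; first by rewrite scale0r add0r submxMl.
by rewrite eqmx_scale // (negbTE eX').
Qed.

(** Write [r] as a vector of [span (X 0)] plus one of [span (Y j)]. As [r] lies in both [span (X j)]
    and [span (Y 0)], subtracting either summand puts the other in the intersection at its end of
    the chain. So [2 * k] coordinates describe [r]. *)
Lemma walk_split j (Q : {set U}) (r : 'rV[K]_n) :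
  (j <= L)%N -> Q \subset X j :\: X 0%N -> (r <= span (X 0%N) + span (Y j))%MS ->
  (r <= span Q)%MS -> exists a b, r = a *m B 0%N + b *m B j.
Proof.
move=> jL QX /sub_addsmxP[[x y] /= rE] rQ.
have xX : (x *m span (X 0%N) <= span (X 0%N))%MS by apply: submxMl.
have yY : (y *m span (Y j) <= span (Y j))%MS by apply: submxMl.
have X0j : X 0%N \subset X j by apply: walkS.
have rX : (r <= span (X j))%MS.
  by rewrite (submx_trans rQ) // spanS // (subset_trans QX) ?subsetDl.
have rY : (r <= span (Y 0%N))%MS.
  by rewrite (submx_trans rQ) // spanS // (subset_trans QX) ?setSD ?XE.
have /submxP[b bE] : (y *m span (Y j) <= B j)%MS.
  rewrite (BG jL) sub_capmx yY andbT.
  rewrite (_ : y *m _ = r - x *m span (X 0%N)); last by rewrite rE addrC addKr.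
  by rewrite addmx_sub // eqmx_opp (submx_trans xX) ?spanS.
have /submxP[a aE] : (x *m span (X 0%N) <= B 0%N)%MS.
  rewrite (BG (leq0n L)) sub_capmx xX /=.
  rewrite (_ : x *m _ = r - y *m span (Y j)); last by rewrite rE addrK.
  by rewrite addmx_sub // eqmx_opp (submx_trans yY) ?spanS // setDS.
by exists a, b; rewrite rE bE aE.
Qed.

(* The state is the linear relation between the (identified) intersections at
   times [0] and [i] that holds modulo the contracted elements added so far.
   Over a finite field there are at most 2 ^ (q ^ k * q ^ k) states. *)
Definition walk_state i (a b : 'rV[K]_k) : bool :=
  ((a *m B 0%N + b *m B i)%R <= span (C :&: (X i :\: X 0%N)))%MS.

(** For [r] with coordinates [a], [b], membership in [span W1] is the state at [j]. Modulo the
    elements outside [C] added after time [i], which all belong to [W2], the basis [B j] can be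
    replaced by [B i]; [walk_indep] then discards those elements, so membership in [span W2] is the
    state at [i]. *)
Lemma walk_switch i j : (i <= j)%N -> (j <= L)%N ->
  walk_state i =2 walk_state j ->
  let W1 := C :&: (X j :\: X 0%N) in
  let W2 := (C :&: (X i :\: X 0%N)) :|: (X j :\: X i :\: C) in
  forall r : 'rV[K]_n, (r <= span (X 0%N) + span (Y j))%MS ->
    (r <= span W1)%MS = (r <= span W2)%MS.
Proof.
move=> ij jL Rij W1 W2 r rP; have iL := leq_trans ij jL.
have X0i : X 0%N \subset X i by apply: walkS.
have Xij : X i \subset X j by apply: walkS.
have W1s : W1 \subset X j :\: X 0%N by apply: subsetIr.
have W2s : W2 \subset X j :\: X 0%N.
  rewrite subUset (subset_trans (subsetIr _ _)) ?setSD //=.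
  by rewrite (subset_trans (subsetDl _ _)) // setDS.
have dBij b : (b *m (B j - B i) <= span W2)%MS.
  apply: submx_trans (submxMl _ _) _.
  apply: submx_trans (walk_bases_diff ij jL) (spanS _).
  exact: subsetUr.
have dE a b : a *m B 0%N + b *m B j = a *m B 0%N + b *m B i + b *m (B j - B i).
  by rewrite mulmxBr -addrA [b *m B i + _]addrC subrK.
apply/idP/idP => h.
  have [a [b rE]] := walk_split jL W1s rP h.
  move: h; have := Rij a b; rewrite rE /walk_state -/W1 => <-; rewrite dE => h.
  by rewrite addmx_sub // (submx_trans h) // spanS // subsetUl.
have [a [b rE]] := walk_split jL W2s rP h.
have := Rij a b; rewrite {1}rE /walk_state -/W1 => <-.
apply: (walk_indep ij jL) => //.
- by rewrite (subset_trans (subsetIr _ _)) ?subsetDl.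
- rewrite addmx_sub // (submx_trans (submxMl _ _)) //.
    by rewrite (BG (leq0n L)) (submx_trans (capmxSl _ _)) ?spanS.
  by rewrite (BG iL) capmxSl.
- rewrite (_ : _ + _ = r - b *m (B j - B i)); last by rewrite rE dE addrK.
  by rewrite addmx_sub // eqmx_opp.
Qed.
End Walk.
End Span.

Lemma walk_repeat (U : finType) (K : finFieldType) (n : nat) (v : U -> 'rV[K]_n)
    (E C : {set U}) (X : nat -> {set U}) (k : nat) :
  let L := 2 ^ (#|K| ^ k * #|K| ^ k) in
  (forall i, i <= L -> X i \subset E) ->
  (forall i, i <= L -> \rank (span v (X i) :&: span v (E :\: X i)) = k) ->
  (forall i, i < L -> exists e,
    [/\ e \in E, e \notin X i, X i.+1 = e |: X i &
     if e \in C then (v e <= span v (X i))%MS && (v e <= span v (E :\: X i.+1))%MS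
     else ~~ (v e <= span v (X i))%MS && ~~ (v e <= span v (E :\: X i.+1))%MS]) ->
  exists i j, [/\ i < j, j <= L &
    forall Z : {set U}, Z \subset X 0 :|: (E :\: X j) ->
      let W1 := C :&: (X j :\: X 0) in
      let W2 := (C :&: (X i :\: X 0)) :|: (X j :\: X i :\: C) in
      \rank (span v (Z :|: W1)) + \rank (span v W2) =
      \rank (span v (Z :|: W2)) + \rank (span v W1)].
Proof.
move=> L XE rG stepX; have [B [BG dB]] := walk_bases rG stepX (leqnn L).
pose R (i : 'I_L.+1) := [set ab | walk_state v C X B i ab.1 ab.2].
(* There are [L.+1] indices but only [L] sets of pairs of vectors in [K ^ k]. *)
have : ~~ injectiveb R.
  apply/negP => /injectiveP/leq_card.
  by rewrite card_ord -cardsT -powersetT card_powerset cardsT card_prod card_mx mul1n ltnn.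
case/injectivePn => i0 [j0 ne Rij].
wlog ij : i0 j0 ne Rij / i0 < j0.
  have [ij|ji|eq] := ltngtP i0 j0 => H; first exact: H Rij ij.
    by apply: (H j0 i0) => //; rewrite eq_sym.
  by case/eqP: ne; apply: val_inj.
have jL : j0 <= L by rewrite -ltnS.
exists i0, j0; split => // Z ZP W1 W2; rewrite (span_setU v Z W1) (span_setU v Z W2).
apply: (rank_adds_exchange (P := (span v (X 0) + span v (E :\: X j0))%MS)).
  apply: (walk_switch XE stepX BG dB (ltnW ij) jL) => a b.
  by move/setP/(_ (a, b)): Rij; rewrite !inE.
by rewrite -span_setU spanS.
Qed.

(** * The theorem *)

Section Representation.
Variables (U : finType) (M : matroid U) (S T : {set U}).
Hypotheses (mM : is_matroid M) (SE : S \subset ground M)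
  (dST : [disjoint S & T]).
Variables (K : fieldType) (n : nat) (v : U -> 'rV[K]_n).
Hypothesis rv : forall X : {set U}, X \subset ground M ->
  rank M X = \rank (span v X).
Local Notation E := (ground M).

(** The two spans sum to the span of the ground set, so the modular law turns connectivity into the
    dimension of their intersection. *)
Lemma rank_span_cap (X : {set U}) : X \subset E ->
  \rank (span v X :&: span v (E :\: X)) = lambda M X.
Proof.
move=> XE; have := lambdaE mM XE.
rewrite !rv ?subsetDl // => h.
have := mxrank_sum_cap (span v X) (span v (E :\: X)).
rewrite -(span_setU v X (E :\: X)) setUDK // addnC -h => /addIn.
exact.
Qed.

Lemma span_rank_step (e : U) (X : {set U}) : e \in E -> X \subset E ->
  (v e <= span v X)%MS = (rank M (e |: X) == rank M X).
Proof.
move=> eE XE; have eXE : e |: X \subset E by rewrite subUset sub1set eE.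
rewrite !rv // eq_sym (mxrank_leqif_sup (spanS v (subsetUr [set e] X))).
by rewrite span_setU1 addsmx_sub submx_refl andbT.
Qed.

Lemma guts_span (e : U) (X : {set U}) : e \in E -> e \notin S -> e \notin T ->
  tight M S T X -> e \notin X -> tight M S T (e |: X) ->
  kappa (mcontract M e) S T < kappa M S T ->
  (v e <= span v X)%MS && (v e <= span v (E :\: (e |: X)))%MS.
Proof.
move=> eE eS eT tX eX teX kc.
have XE : X \subset E.
  by case/and3P: tX => _ /subset_trans-> //; rewrite subsetDl.
have [h1 h2] := guts_step mM SE dST eE eS eT tX eX teX kc.
by rewrite !span_rank_step ?subsetDl // h1 (setD1_step M) h2 !eqxx.
Qed.

Lemma coguts_span (e : U) (X : {set U}) : e \in E -> e \notin S -> e \notin T ->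
  tight M S T X -> e \notin X -> tight M S T (e |: X) ->
  kappa (mdelete M e) S T < kappa M S T ->
  ~~ (v e <= span v X)%MS && ~~ (v e <= span v (E :\: (e |: X)))%MS.
Proof.
move=> eE eS eT tX eX teX kc.
have XE : X \subset E.
  by case/and3P: tX => _ /subset_trans-> //; rewrite subsetDl.
have [h1 h2] := coguts_step mM SE dST eE eS eT tX eX teX kc.
rewrite !span_rank_step ?subsetDl // h1 (setD1_step M) h2.
by rewrite !gtn_eqF.
Qed.
End Representation.

Theorem theorem1p2 :
  exists c : nat -> nat -> nat -> nat,
  forall (U : finType) (q : nat) (M N : matroid U) (S T : {set U}),
    prime_power q ->
    is_matroid M ->
    GF_representable q M ->
    is_minor N M ->
    S \subset ground M -> T \subset ground M -> [disjoint S & T] ->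
    let k := kappa M S T in
    c q #|ground N| k < #|ground M :\: (S :|: T :|: ground N)| ->
    exists2 e, e \in ground M :\: (S :|: T :|: ground N) &
      (kappa (mdelete M e) S T = k /\ is_minor N (mdelete M e)) \/
      (kappa (mcontract M e) S T = k /\ is_minor N (mcontract M e)).
Proof.
(* The first factor is the run length that forces a repeated state; the second counts the pieces
   into which the elements of [N] can cut the chain. *)
exists (fun q m k => 2 ^ (q ^ k * q ^ k) * m.+1).
move=> U q M N S T _ mM [K [<- [n [v rv]]]] [C [D [CE DE dCD gN rN]]].
move=> SE TE dST k hc; set F := ground M :\: _ in hc *.
have FP e : e \in F -> [/\ e \in ground M, e \notin S, e \notin T & e \notin ground N].
  by rewrite !inE !negb_or -!andbA => /and4P[].
have FCD e : e \in F -> (e \in C) || (e \in D).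
  case/FP=> eE _ _; rewrite gN !inE eE andbT negbK //.
(* If some [e] can be removed as the given [C] and [D] prescribe without lowering the connectivity,
   the theorem follows at once. *)
pose good e := (e \in C) && (kappa (mcontract M e) S T == k) ||
               (e \in D) && (kappa (mdelete M e) S T == k).
have [/existsP[e /andP[eF]]|/existsPn bad] := boolP [exists e in F, good e].
  case/orP=> /andP[eCD /eqP ke]; exists e => //; [right|left]; split => //.
    exact: minor_contract mM CE DE dCD gN rN eCD.
  exact: minor_delete CE DE dCD gN rN eCD.
have kle e : e \in F -> kappa (mdelete M e) S T <= k /\
                        kappa (mcontract M e) S T <= k.
  by case/FP=> eE eS eT _; apply: kappa_minor_le.
have badC e : e \in F -> e \in C -> kappa (mcontract M e) S T < k.
  move=> eF eC; move: (bad e); rewrite /good eF eC /= negb_or => /andP[ne _].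
  by rewrite ltn_neqAle ne (kle e eF).2.
have badD e : e \in F -> e \in D -> kappa (mdelete M e) S T < k.
  move=> eF eD; move: (bad e); rewrite /good eF eD /= negb_or => /andP[_ ne].
  by rewrite ltn_neqAle ne (kle e eF).1.
have tF e : e \in F ->
    exists X : {set U}, [/\ tight M S T X, e \notin X & tight M S T (e |: X)].
  move=> eF; have [eE eS eT _] := FP e eF; apply: tight_exists => //.
  by case/orP: (FCD e eF) => h; [right; apply: badC | left; apply: badD].
have [X0 [s [tX0 ps sL]]] := long_run mM SE dST tF (ltnW hc).
pose X i := nth X0 (X0 :: s) i; set L := 2 ^ _ in sL.
have stepX i : i < L -> run_step M S T (ground N) (X i) (X i.+1).
  by rewrite -sL => iL; apply: (pathP X0 ps).
have tX i : i <= L -> tight M S T (X i).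
  by case: i => [//|i] /stepX /andP[].
have XE i : i <= L -> X i \subset ground M.
  by move/tX/and3P=> [_ /subset_trans-> //]; rewrite subsetDl.
have stepF i : i < L -> exists e, [/\ e \in F, e \notin X i & X i.+1 = e |: X i].
  by move/stepX/andP=> [_ /existsP[e /and3P[eF eX /eqP Xe]]]; exists e.
have XF j : j <= L -> X j :\: X 0 \subset F.
  elim: j => [|j IHj] jL; first by rewrite setDv sub0set.
  have [e [eF _ ->]] := stepF j jL.
  by rewrite setDUl subUset IHj 1?ltnW // (subset_trans (subsetDl _ _)) ?sub1set.
have [||i [j [ij jL H]]] := walk_repeat (C := C) (k := k) (v := v) XE.
- move=> i /[dup] /XE XiE /tX /and3P[_ _ /eqP lk].
  exact: etrans (rank_span_cap mM rv XiE) lk.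
- move=> i iL; have [e [eF eX Xe]] := stepF i iL.
  have [eE eS eT _] := FP e eF; exists e; split => //.
  have tXi := tX i (ltnW iL); have := tX i.+1 iL; rewrite Xe => teX.
  case: ifPn => eC; first exact: guts_span (badC e eF eC).
  have eD : e \in D by move: (FCD e eF); rewrite (negbTE eC).
  exact: coguts_span (badD e eF eD).
have iL : i < L by apply: leq_trans ij jL.
have [e [eF eX Xe]] := stepF i iL; have [eE eS eT _] := FP e eF.
have XS a b : a <= b -> b <= L -> X a \subset X b.
  elim: b => [|b IHb]; first by rewrite leqn0 => /eqP->.
  rewrite leq_eqVlt => /orP[/eqP -> //|]; rewrite ltnS => ab bL.
  have [x [_ _ ->]] := stepF b bL.
  by rewrite (subset_trans (IHb ab (ltnW bL))) ?subsetUr.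
have X0i := XS 0 i (leq0n _) (ltnW iL); have Xij := XS i j (ltnW ij) jL.
have eW : e \in X j :\: X i.
  by rewrite inE eX (subsetP (XS i.+1 j ij jL)) // Xe !inE eqxx.
(* An opaque [W] keeps membership in it atomic in the Boolean case analyses, until [defW] is
   used. *)
have [W defW] : exists W : {set U}, W = X j :\: X i by exists (X j :\: X i).
rewrite -defW in H eW.
have WF : W \subset F.
  by rewrite defW; apply: subset_trans (XF j jL); apply: setDS.
have WE : W \subset ground M by rewrite defW (subset_trans (subsetDl _ _)) ?XE.
(* Contraction and deletion are exchanged on [W], by symmetric difference. *)
pose C' := (C :\: W) :|: (W :\: C); pose D' := (D :\: W) :|: (W :\: D).
have sD (A B : {set U}) : A \subset ground M -> A :\: B \subset ground M.
  exact: subset_trans (subsetDl _ _).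
have C'E : C' \subset ground M by rewrite subUset (sD _ _ CE) (sD _ _ WE).
have D'E : D' \subset ground M by rewrite subUset (sD _ _ DE) (sD _ _ WE).
have WCD z : (z \in W) ==> (z \in C) || (z \in D).
  by apply/implyP => /(subsetP WF)/FCD.
have CDx z : ~~ ((z \in C) && (z \in D)).
  by apply/andP => -[zC]; rewrite (disjointFr dCD).
have dCD' : [disjoint C' & D'].
  rewrite disjoint_subset; apply/subsetP => z; rewrite !inE !negb_or !negb_and !negbK.
  have := WCD z; have := CDx z.
  by case: (z \in W); case: (z \in C); case: (z \in D).
have gN' : ground N = ground M :\: (C' :|: D').
  rewrite gN; congr (_ :\: _); apply/setP => z; rewrite !inE.
  have := WCD z; have := CDx z.
  by case: (z \in W); case: (z \in C); case: (z \in D).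
have rC' (Z : {set U}) : Z \subset ground N ->
    rank M (Z :|: C) + \rank (span v (C :&: (X i :\: X 0) :|: (W :\: C))) =
    rank M (Z :|: C') + \rank (span v (C :&: (X j :\: X 0))).
  move=> ZN; have ZE : Z \subset ground M by rewrite (subset_trans ZN) // gN subsetDl.
  have ZCE : Z :|: C \subset ground M by rewrite subUset ZE.
  have ZCE' : Z :|: C' \subset ground M by rewrite subUset ZE.
  rewrite (rv _ ZCE) (rv _ ZCE').
  (* The exchange is applied to the part of [Z :|: C] outside the chain segment; adding [W1] or [W2]
     restores [Z :|: C] or produces [Z :|: C']. Here [Z] misses the segment, which lies in [F]. *)
  have := H ((Z :|: C) :\: (X j :\: X 0)); rewrite /=.
  have ZX z : z \in Z -> z \notin X j :\: X 0.
    move=> zZ; apply/negP => /(subsetP (XF j jL)) /FP[_ _ _].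
    by rewrite (subsetP ZN).
  have -> : (Z :|: C) :\: (X j :\: X 0) :|: C :&: (X j :\: X 0) = Z :|: C.
    apply/setP => z; have := ZX z; rewrite !inE => /implyP.
    by case: (z \in X 0); case: (z \in X j); case: (z \in Z); case: (z \in C).
  have -> : (Z :|: C) :\: (X j :\: X 0) :|:
      (C :&: (X i :\: X 0) :|: (W :\: C)) = Z :|: C'.
    apply/setP => z; have := ZX z; rewrite /C' defW !inE => /implyP.
    have /implyP := subsetP X0i z; have /implyP := subsetP Xij z.
    by case: (z \in X 0); case: (z \in X i); case: (z \in X j);
      case: (z \in Z); case: (z \in C).
  apply; apply/subsetP => z; rewrite !inE negb_and negbK => /andP[h zZC].
  by case/orP: h => [->//|->]; rewrite (subsetP ZCE) ?orbT // inE.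
(* Comparing the identity for [Z] with that for [set0] cancels the two span ranks. *)
have rN' (Z : {set U}) : Z \subset ground N -> rank N Z = rank M (Z :|: C') - rank M C'.
  move=> ZN; rewrite rN //; have := rC' Z ZN; have := rC' set0 (sub0set _).
  rewrite !set0U; move: (\rank _) (\rank _) (rank M _) (rank M _) (rank M _) (rank M _).
  by clear; lia.
exists e => //; have [kd kc] := kle e eF.
(* The prescribed removal of [e] lowers the connectivity, so by linking the other one preserves it,
   and the exchanged sets present [N] with that removal. *)
have kdc := kappa_del_or_con mM SE dST eE eS eT.
have [eC|eC] := boolP (e \in C).
  have kC := badC e eF eC; left; split.
    by apply/eqP; rewrite eqn_leq kd; case: kdc => //; rewrite leqNgt kC.
  by apply: (minor_delete C'E D'E dCD' gN' rN'); rewrite !inE eW (disjointFr dCD eC).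
have eD : e \in D by move: (FCD e eF); rewrite (negbTE eC).
have kD := badD e eF eD; right; split.
  by apply/eqP; rewrite eqn_leq kc; case: kdc => //; rewrite leqNgt kD.
by apply: (minor_contract mM C'E D'E dCD' gN' rN'); rewrite !inE eW (negbTE eC).
Qed.
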